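(* For every set of formulas $\Gamma\cup\{A\}\subseteq For(\Sigma)$: if $\Gamma\vdash_{LET_K} A$ then $\Gamma\models_{\mathcal{M}_{LET_K}} A$.
   Context: Fix a denumerable set of propositional variables and let $For(\Sigma)$ be the set of formulas over $\Sigma=\{\land,\lor,\to,\neg,\circ\}$. The logic $LET_K$ is given by the natural deduction system with the following rules (derivations defined as usual; bracketed hypotheses are discharged); $\Gamma\vdash_{LET_K}A$ means $A$ is derivable from premises in $\Gamma$: ($\land$I) from $A$ and $B$ infer $A\land B$; ($\land$E) from $A\land B$ infer $A$, and infer $B$; ($\lor$I) from $A$ infer $A\lor B$, from $B$ infer $A\lor B$; ($\lor$E) from $A\lor B$, a derivation of $C$ from $[A]$ and a derivation of $C$ from $[B]$, infer $C$; ($\neg\land$I) from $\neg A$ infer $\neg(A\land B)$, from $\neg B$ infer $\neg(A\land B)$; ($\neg\land$E) from $\neg(A\land B)$, a derivation of $C$ from $[\neg A]$ and one of $C$ from $[\neg B]$, infer $C$; ($\neg\lor$I) from $\neg A$ and $\neg B$ infer $\neg(A\lor B)$; ($\neg\lor$E) from $\neg(A\lor B)$ infer $\neg A$, and infer $\neg B$; (DN) from $A$ infer $\neg\neg A$, and from $\neg\neg A$ infer $A$; ($\to$I) from a derivation of $B$ from $[A]$ infer $A\to B$; ($\to$E) from $A\to B$ and $A$ infer $B$; ($\to_{CL}$) axiom $A\lor(A\to B)$; ($\neg\to$I) from $A$ and $\neg B$ infer $\neg(A\to B)$; ($\neg\to$E) from $\neg(A\to B)$ infer $A$, and infer $\neg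 B$; (EXP$^\circ$) from $\circ A$, $A$, $\neg A$ infer $B$; (PEM$^\circ$) from $\circ A$ infer $A\lor\neg A$. Let $\{0,1\}$ be the two-element Boolean algebra with $\sqcap,\sqcup,\sim$ and $a\Rightarrow b=\sim a\sqcup b$. An Nmatrix is a triple $(M,\mathrm{D},\mathcal{O})$ with $\emptyset\ne\mathrm{D}\subseteq M$ and $\mathcal{O}(\#):M^n\to\wp(M)\setminus\{\emptyset\}$ for each $n$-ary connective $\#$; a valuation is a map $v$ with $v(\#(A_1,\dots,A_n))\in\mathcal{O}(\#)(v(A_1),\dots,v(A_n))$; $\Gamma\models A$ iff every valuation mapping all of $\Gamma$ into $\mathrm{D}$ maps $A$ into $\mathrm{D}$. The Nmatrix $\mathcal{M}_{LET_K}$ has domain $B_{LET_K}=\{z\in\{0,1\}^3: z_3\le z_1\sqcup z_2,\ z_1\sqcap z_2\sqcap z_3=0\}=\{T=(1,0,1),T_0=(1,0,0),\mathsf{b}=(1,1,0),\mathsf{n}=(0,0,0),F_0=(0,1,0),F=(0,1,1)\}$, designated set $\mathrm{D}=\{z:z_1=1\}=\{T,T_0,\mathsf{b}\}$, and multioperations ($u$ ranging over $B_{LET_K}$): $z\tilde\land w=\{u:u_1=z_1\sqcap w_1,u_2=z_2\sqcup w_2\}$; $z\tilde\lor w=\{u:u_1=z_1\sqcup w_1,u_2=z_2\sqcap w_2\}$; $z\tilde\to w=\{u:u_1=z_1\Rightarrow w_1,u_2=z_1\sqcap w_2\}$; $\tilde\neg z=\{u:u_1=z_2,u_2=z_1\}$;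 $\tilde\circ z=\{u:u_1=z_3\}$. $\models_{\mathcal{M}_{LET_K}}$ is the induced consequence relation. *)

(* Defs.v *)
From mathcomp Require Import all_boot classical_sets.

Set Implicit Arguments.
Unset Strict Implicit.
Unset Printing Implicit Defensive.

Local Open Scope classical_set_scope.

Inductive unary_connective : Set := cneg | ccirc.
Inductive binary_connective : Set := cand | cor | cimp.

Inductive formula : Set :=
| Var of nat
| Un of unary_connective & formula
| Bin of binary_connective & formula & formula.

Notation Neg := (Un cneg).
Notation Circ := (Un ccirc).
Notation And := (Bin cand).
Notation Or := (Bin cor).
Notation Imp := (Bin cimp).

(* Natural deduction with explicit premises: [derivable G A] says that some
   (finite) derivation of A has all its undischarged hypotheses in G, which may
   be infinite; a subderivation from a discharged hypothesis H has premises in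
   [G `|` [set H]]. *)
Inductive derivable : set formula -> formula -> Prop :=
| d_hyp G A : G A -> derivable G A
| d_andI G A B : derivable G A -> derivable G B -> derivable G (And A B)
| d_andE1 G A B : derivable G (And A B) -> derivable G A
| d_andE2 G A B : derivable G (And A B) -> derivable G B
| d_orI1 G A B : derivable G A -> derivable G (Or A B)
| d_orI2 G A B : derivable G B -> derivable G (Or A B)
| d_orE G A B C : derivable G (Or A B) ->
    derivable (G `|` [set A]) C -> derivable (G `|` [set B]) C ->
    derivable G C
| d_negandI1 G A B : derivable G (Neg A) -> derivable G (Neg (And A B))
| d_negandI2 G A B : derivable G (Neg B) -> derivable G (Neg (And A B))
| d_negandE G A B C : derivable G (Neg (And A B)) ->
    derivable (G `|` [set Neg A]) C -> derivable (G `|` [set Neg B]) C ->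
    derivable G C
| d_negorI G A B : derivable G (Neg A) -> derivable G (Neg B) ->
    derivable G (Neg (Or A B))
| d_negorE1 G A B : derivable G (Neg (Or A B)) -> derivable G (Neg A)
| d_negorE2 G A B : derivable G (Neg (Or A B)) -> derivable G (Neg B)
| d_dnI G A : derivable G A -> derivable G (Neg (Neg A))
| d_dnE G A : derivable G (Neg (Neg A)) -> derivable G A
| d_impI G A B : derivable (G `|` [set A]) B -> derivable G (Imp A B)
| d_impE G A B : derivable G (Imp A B) -> derivable G A -> derivable G B
| d_impCL G A B : derivable G (Or A (Imp A B))
| d_negimpI G A B : derivable G A -> derivable G (Neg B) ->
    derivable G (Neg (Imp A B))
| d_negimpE1 G A B : derivable G (Neg (Imp A B)) -> derivable G A
| d_negimpE2 G A B : derivable G (Neg (Imp A B)) -> derivable G (Neg B)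
| d_exp G A B : derivable G (Circ A) -> derivable G A -> derivable G (Neg A) ->
    derivable G B
| d_pem G A : derivable G (Circ A) -> derivable G (Or A (Neg A)).

Record nmatrix := Nmatrix {
  carrier : Type;
  designated : set carrier;
  designated_nonempty : designated !=set0;
  op1 : unary_connective -> carrier -> set carrier;
  op1_nonempty : forall c x, op1 c x !=set0;
  op2 : binary_connective -> carrier -> carrier -> set carrier;
  op2_nonempty : forall c x y, op2 c x y !=set0 }.

Definition valuation (M : nmatrix) (v : formula -> carrier M) : Prop :=
  (forall c A, op1 c (v A) (v (Un c A))) /\
  (forall c A B, op2 c (v A) (v B) (v (Bin c A B))).

Definition consequence (M : nmatrix) (G : set formula) (A : formula) : Prop :=
  forall v : formula -> carrier M, valuation v ->
    (forall B, G B -> designated (v B)) -> designated (v A).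

(* On [bool], [a ==> b] is both the order a <= b and the Boolean implication
   [~~ a || b]. *)
Definition is_snapshot (z : bool * bool * bool) : bool :=
  let: (z1, z2, z3) := z in (z3 ==> z1 || z2) && ~~ [&& z1, z2 & z3].

Definition BLETK : Type := {z : bool * bool * bool | is_snapshot z}.

Definition pr1 (z : BLETK) : bool := (val z).1.1.
Definition pr2 (z : BLETK) : bool := (val z).1.2.
Definition pr3 (z : BLETK) : bool := (val z).2.

Definition LETK_designated : set BLETK := [set z | pr1 z = true].

Definition LETK_op1 (c : unary_connective) (z : BLETK) : set BLETK :=
  match c with
  | cneg => [set u | pr1 u = pr2 z /\ pr2 u = pr1 z]
  | ccirc => [set u | pr1 u = pr3 z]
  end.

Definition LETK_op2 (c : binary_connective) (z w : BLETK) : set BLETK :=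
  match c with
  | cand => [set u | pr1 u = pr1 z && pr1 w /\ pr2 u = pr2 z || pr2 w]
  | cor => [set u | pr1 u = pr1 z || pr1 w /\ pr2 u = pr2 z && pr2 w]
  | cimp => [set u | pr1 u = (pr1 z ==> pr1 w) /\ pr2 u = pr1 z && pr2 w]
  end.

Lemma is_snapshot_false (a b : bool) : is_snapshot (a, b, false).
Proof. by case: a; case: b. Qed.

Definition snapshot0 (a b : bool) : BLETK :=
  exist _ (a, b, false) (is_snapshot_false a b).

Lemma LETK_designated_nonempty : LETK_designated !=set0.
Proof. by exists (snapshot0 true true). Qed.

Lemma LETK_op1_nonempty c z : LETK_op1 c z !=set0.
Proof.
case: c; first by exists (snapshot0 (pr2 z) (pr1 z)).
by exists (snapshot0 (pr3 z) true).
Qed.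

Lemma LETK_op2_nonempty c z w : LETK_op2 c z w !=set0.
Proof.
case: c.
- by exists (snapshot0 (pr1 z && pr1 w) (pr2 z || pr2 w)).
- by exists (snapshot0 (pr1 z || pr1 w) (pr2 z && pr2 w)).
- by exists (snapshot0 (pr1 z ==> pr1 w) (pr1 z && pr2 w)).
Qed.

Definition MLETK : nmatrix :=
  Nmatrix LETK_designated_nonempty LETK_op1_nonempty LETK_op2_nonempty.

(* Main.v *)
Require Import Defs.
From mathcomp Require Import all_boot classical_sets.

Local Open Scope classical_set_scope.

(** Fix a valuation [v] and induct on the derivation. Nondeterminism never touches [pr1] and [pr2]
    of a formula built without [Circ] at its head: they obey Boolean equations ([valuationE]) in
    which [pr2 (v A)] is the truth value of [Neg A]. Each rule without [Circ] thus becomes a Boolean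
    fact. The two [Circ] rules read [pr3], which the snapshot constraints tie to [pr1] and [pr2]
    ([snapshot_circ]). *)

(** The two constraints defining snapshots, at third coordinate true: the first conjunct validates
    [d_pem], the second [d_exp]. *)
Lemma snapshot_circ (z : BLETK) :
  pr3 z -> (pr1 z || pr2 z) && ~~ (pr1 z && pr2 z).
Proof. by case: z => [[[[] []] []]]. Qed.

Section ValuationEquations.
Variables (v : formula -> BLETK) (val_v : valuation (M := MLETK) v).

Lemma pr1_Neg A : pr1 (v (Neg A)) = pr2 (v A).
Proof. exact: (val_v.1 cneg A).1. Qed.

Lemma pr2_Neg A : pr2 (v (Neg A)) = pr1 (v A).
Proof. exact: (val_v.1 cneg A).2. Qed.

Lemma pr1_Circ A : pr1 (v (Circ A)) = pr3 (v A).
Proof. exact: (val_v.1 ccirc A). Qed.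

Lemma pr1_And A B : pr1 (v (And A B)) = pr1 (v A) && pr1 (v B).
Proof. exact: (val_v.2 cand A B).1. Qed.

Lemma pr2_And A B : pr2 (v (And A B)) = pr2 (v A) || pr2 (v B).
Proof. exact: (val_v.2 cand A B).2. Qed.

Lemma pr1_Or A B : pr1 (v (Or A B)) = pr1 (v A) || pr1 (v B).
Proof. exact: (val_v.2 cor A B).1. Qed.

Lemma pr2_Or A B : pr2 (v (Or A B)) = pr2 (v A) && pr2 (v B).
Proof. exact: (val_v.2 cor A B).2. Qed.

Lemma pr1_Imp A B : pr1 (v (Imp A B)) = (pr1 (v A) ==> pr1 (v B)).
Proof. exact: (val_v.2 cimp A B).1. Qed.

Lemma pr2_Imp A B : pr2 (v (Imp A B)) = pr1 (v A) && pr2 (v B).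
Proof. exact: (val_v.2 cimp A B).2. Qed.

(** A rewrite multirule; [pr2 (v (Circ A))] has no equation because the multioperation for [ccirc]
    leaves it free. *)
Definition valuationE :=
  (pr1_Neg, pr2_Neg, pr1_Circ, pr1_And, pr2_And, pr1_Or, pr2_Or,
   pr1_Imp, pr2_Imp).

End ValuationEquations.

Definition satisfies (v : formula -> BLETK) (G : set formula) : Prop :=
  forall B, G B -> pr1 (v B).

Lemma satisfiesU1 v G A :
  satisfies v G -> pr1 (v A) -> satisfies v (G `|` [set A]).
Proof. by move=> vG vA B [/vG | ->]. Qed.

(** [satisfies v G] follows the derivation so that the induction hypotheses cover the enlarged
    premise sets of discharging rules, which [satisfiesU1] handles. *)
Lemma soundness v G A : valuation (M := MLETK) v ->
  derivable G A -> satisfies v G -> pr1 (v A).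
Proof.
move=> val_v; have E := valuationE _ val_v.
elim=> {G A}.
- by move=> G A GA; apply.
- by move=> G A B _ IHA _ IHB vG; rewrite E IHA ?IHB.
- by move=> G A B _ IH /IH; rewrite E => /andP[].
- by move=> G A B _ IH /IH; rewrite E => /andP[].
- by move=> G A B _ IH /IH; rewrite E => ->.
- by move=> G A B _ IH /IH; rewrite E orbC => ->.
- move=> G A B C _ IH _ IHA _ IHB vG.
  by move: (IH vG); rewrite E => /orP[/(satisfiesU1 _ _ _ vG)/IHA
    | /(satisfiesU1 _ _ _ vG)/IHB].
- by move=> G A B _ IH /IH; rewrite !E => ->.
- by move=> G A B _ IH /IH; rewrite !E orbC => ->.
- move=> G A B C _ IH _ IHA _ IHB vG.
  (* Folding [pr2] back into [pr1] of a negation matches the discharged hypotheses [Neg A] and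
     [Neg B]. *)
  move: (IH vG); rewrite !E -!(pr1_Neg _ val_v).
  by case/orP=> [/(satisfiesU1 _ _ _ vG)/IHA | /(satisfiesU1 _ _ _ vG)/IHB].
- move=> G A B _ IHA _ IHB vG; move: (IHA vG) (IHB vG).
  by rewrite !E => -> ->.
- by move=> G A B _ IH /IH; rewrite !E => /andP[].
- by move=> G A B _ IH /IH; rewrite !E => /andP[].
- by move=> G A _ IH /IH; rewrite !E.
- by move=> G A _ IH /IH; rewrite !E.
- move=> G A B _ IH vG; rewrite E.
  by apply/implyP => /(satisfiesU1 _ _ _ vG)/IH.
- move=> G A B _ IHAB _ IHA vG.
  by move: (IHAB vG); rewrite E (IHA vG).
- by move=> G A B _; rewrite !E; case: (pr1 (v A)).
- by move=> G A B _ IHA _ IHB vG; move: (IHB vG); rewrite !E (IHA vG).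
- by move=> G A B _ IH /IH; rewrite !E => /andP[].
- by move=> G A B _ IH /IH; rewrite !E => /andP[].
- move=> G A B _ IHc _ IHA _ IHN vG.
  move: (IHc vG) (IHA vG) (IHN vG); rewrite !E.
  by move=> /snapshot_circ/andP[_ /negP nAN] vA vN; case: nAN; rewrite vA.
- by move=> G A _ IH /IH; rewrite !E => /snapshot_circ/andP[].
Qed.

Theorem theorem2p15 (G : set formula) (A : formula) :
  derivable G A -> consequence MLETK G A.
(* Designation in [MLETK] unfolds to [pr1 z = true], which is the coercion used in [soundness]. *)
Proof. by move=> dA v val_v; apply: soundness. Qed.
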